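(* Let $a,b>0$ and let $\chi_a,\chi_b:\mathbb{R}\to\mathbb{R}$ be two continuous kernels such that $\operatorname{supp}\chi_a\subseteq[-a,a]$ and $\operatorname{supp}\chi_b\subseteq[-b,b]$. Let $\alpha\in\mathbb{R}$ be fixed, and set $$\chi(x):=(1-\alpha)\,\chi_a(x-a-1)+\alpha\,\chi_b(x+b),\qquad x\in\mathbb{R}.$$ Then $\chi$ is a kernel. Furthermore, for every bounded, locally integrable function $f:\mathbb{R}\to\mathbb{R}$ and every (non-removable) jump discontinuity $t\in\mathbb{R}$ of $f$, the sampling Kantorovich operators $S_wf$, $w>0$, based upon $\chi$ satisfy $$\lim_{w\to+\infty}(S_wf)(t)=\alpha\,f(t+0)+(1-\alpha)\,f(t-0).$$
   Context: A function $\chi:\mathbb{R}\to\mathbb{R}$ is called a kernel if: (1) $\chi\in L^1(\mathbb{R})$ and $\chi$ is bounded on $[-1,1]$; (2) $\sum_{k\in\mathbb{Z}}\chi(u-k)=1$ for every $u\in\mathbb{R}$; (3) for some $\beta>0$, $m_\beta(\chi):=\sup_{u\in\mathbb{R}}\sum_{k\in\mathbb{Z}}|\chi(u-k)|\,|u-k|^\beta<+\infty$. For a kernel $\chi$ and $w>0$, the sampling Kantorovich operator based upon $\chi$ is $(S_wf)(t):=\sum_{k\in\mathbb{Z}}\chi(wt-k)\left[w\int_{k/w}^{(k+1)/w}f(u)\,du\right]$, $t\in\mathbb{R}$, for locally integrable $f:\mathbb{R}\to\mathbb{R}$ such that the series converges for each $t\in\mathbb{R}$ (this holds for bounded measurable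 $f$). Notation: $f(t\pm0):=\lim_{\varepsilon\to0^+}f(t\pm\varepsilon)$; a (non-removable) jump discontinuity at $t$ means that both limits $f(t+0)$, $f(t-0)$ exist and are finite and $f(t+0)\neq f(t-0)$. *)

(* Defs.v *)
From HB Require Import structures.
From mathcomp Require Export all_boot all_order all_algebra.
From mathcomp Require Export all_classical all_reals all_analysis.
Export numFieldNormedType.Exports.
Export Order.TTheory GRing.Theory Num.Theory.

Set Implicit Arguments.
Unset Strict Implicit.
Unset Printing Implicit Defensive.

Local Open Scope classical_set_scope.
Local Open Scope ring_scope.

Section sampling_kantorovich.
Context {R : realType}.
Implicit Types (f chi : R -> R) (u : int -> R) (w t beta : R).

(* [lebesgue_measure] lives on the Borel sets only; its completion is used so
   that integrable functions are the Lebesgue-integrable ones. *)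
Local Notation mu := (@completed_lebesgue_measure R).

(* A series over Z converges when both of its halves (k >= 0 and k < 0) do;
   [Negz n] is - (n + 1). *)
Definition zseries_converges u : Prop :=
  cvgn (series (fun n => u (Posz n))) /\ cvgn (series (fun n => u (Negz n))).

(* Meaningful only under [zseries_converges u], as [lim] is total. *)
Definition zsum u : R :=
  limn (series (fun n => u (Posz n))) + limn (series (fun n => u (Negz n))).

Definition abs_moment beta chi : \bar R :=
  ereal_sup [set (\esum_(k in [set: int])
     (`|chi (v - k%:~R)| * `|v - k%:~R| `^ beta)%:E)%E | v in [set: R]].

Definition is_kernel chi : Prop :=
  [/\ mu.-integrable setT (EFin \o chi) /\
        [bounded chi x | x in `[-1, 1]%classic],
      forall v : R, zseries_converges (fun k : int => chi (v - k%:~R)) /\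
        zsum (fun k : int => chi (v - k%:~R)) = 1 &
      exists2 beta : R, 0 < beta & (abs_moment beta chi < +oo)%E].

(* Counterpart for the completed measure of the library's
   [locally_integrable setT], which requires Borel measurability. *)
Definition loc_integrable f : Prop :=
  forall K : set R, compact K -> mu.-integrable K (EFin \o f).

Definition kantorovich_term chi w f t (k : int) : R :=
  chi (w * t - k%:~R) *
  (w * \int[mu]_(x in `[k%:~R / w, (k + 1)%:~R / w]) f x).

Definition kantorovich_dom chi w f : Prop :=
  loc_integrable f /\ forall t, zseries_converges (kantorovich_term chi w f t).

Definition kantorovich chi w f t : R := zsum (kantorovich_term chi w f t).

Definition right_lim f t : R := lim (f (t + e) @[e --> 0^'+]).
Definition left_lim f t : R := lim (f (t - e) @[e --> 0^'+]).

Definition jump_discontinuity f t : Prop :=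
  [/\ cvg (f (t + e) @[e --> 0^'+]), cvg (f (t - e) @[e --> 0^'+]) &
      right_lim f t <> left_lim f t].

Definition supp chi : set R := closure [set x | chi x != 0].

End sampling_kantorovich.

(* Main.v *)
(* The part of [chi] coming from [chi_a] vanishes at [w t - k] unless
   t - (2 a + 1) / w < k / w and (k + 1) / w < t, so it only samples means of [f]
   over intervals lying strictly to the left of [t] and shrinking to it; the part
   coming from [chi_b] only samples the right of [t]. As the translates of each
   kernel sum to 1, the two parts converge to [f (t - 0)] and [f (t + 0)]. *)
Require Import Defs.
From mathcomp Require finmap.
From mathcomp Require Import ring lra zify measurable_realfun.

Set Implicit Arguments.
Unset Strict Implicit.
Unset Printing Implicit Defensive.

Local Open Scope classical_set_scope.
Local Open Scope ring_scope.

(** * Linearity and absolute convergence of series over the integers *)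

Section integer_series.
Context {R : realType}.
Implicit Types (u v : int -> R) (c C : R).

Lemma zsumD u v : zseries_converges u -> zseries_converges v ->
  zseries_converges (fun k => u k + v k) /\
  zsum (fun k => u k + v k) = zsum u + zsum v.
Proof.
move=> [up un] [vp vn]; split.
  by split; exact: is_cvg_seriesD.
rewrite /zsum [X in X + _](lim_seriesD up vp) [X in _ + X](lim_seriesD un vn).
by rewrite addrACA.
Qed.

Lemma zsumZ c u : zseries_converges u ->
  zseries_converges (fun k => c * u k) /\
  zsum (fun k => c * u k) = c * zsum u.
Proof.
move=> [up un]; split.
  by split; exact: is_cvg_seriesZ.
rewrite /zsum [X in X + _](lim_seriesZ c up) [X in _ + X](lim_seriesZ c un).
by rewrite mulrDr.
Qed.

(** Injectivity of [h] turns each partial sum of absolute values into a sum over a duplicate-free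
    list, so these increasing partial sums stay below [C]. *)
Lemma series_dominated (h : nat -> int) u C : injective h ->
  (forall s : seq int, uniq s -> \sum_(k <- s) `|u k| <= C) ->
  cvgn (series (u \o h)) /\ `|limn (series (u \o h))| <= C.
Proof.
move=> h_inj uC.
have bnd n : [normed series (u \o h)] n <= C.
  rewrite /= /series /= -(big_map h xpredT (fun k => `|u k|)).
  by apply: uC; rewrite map_inj_uniq// iota_uniq.
have cvn : cvgn [normed series (u \o h)].
  apply: nondecreasing_is_cvgn; last by exists C => _ [n _ <-]; exact: bnd.
  by apply: nondecreasing_series => // n _ _; exact: normr_ge0.
split; first exact: normed_cvg.
apply: le_trans (lim_series_norm cvn) _.
by apply: limr_le => //; near=> n; exact: bnd.
Unshelve. all: by end_near. Qed.

Lemma zseries_dominated u C :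
  (forall s : seq int, uniq s -> \sum_(k <- s) `|u k| <= C) ->
  zseries_converges u /\ `|zsum u| <= C + C.
Proof.
move=> uC.
have [cp bp] : cvgn (series (u \o Posz)) /\ `|limn (series (u \o Posz))| <= C.
  by apply: series_dominated => // m n [].
have [cn bn] : cvgn (series (u \o Negz)) /\ `|limn (series (u \o Negz))| <= C.
  by apply: series_dominated => // m n [].
split; first by split.
by apply: le_trans (ler_normD _ _) _; exact: lerD.
Qed.

End integer_series.

(** * Continuous functions with compact support: integrability, translates and moments *)

Section compact_support.
Context {R : realType}.
Local Notation mu := (@completed_lebesgue_measure R).
Implicit Types (chi : R -> R) (L : R).

Lemma completed_measurable_itv (i : interval R) :
  measurable ([set` i] : set (caratheodory_type (wlength (R := R) idfun)^*%mu)).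
Proof.
have mi : measurable ([set` i] : set (measurableTypeR R)).
  exact: measurable_itv.
exact: (@sub_caratheodory _ _ _ (wlength idfun) _ mi).
Qed.

Lemma completed_lebesgue_measure_itvcc (x y : R) :
  mu `[x, y]%classic = (Num.max 0 (y - x))%:E.
Proof.
(* Both measures are restrictions of the same outer measure, so their values on an interval agree by
   conversion. *)
transitivity (lebesgue_measure (`[x, y]%classic : set R)); first by [].
rewrite lebesgue_measure_itv/= lte_fin -EFinB; have [xy|yx] := ltP x y.
  by rewrite max_r// subr_ge0 ltW.
by rewrite max_l// subr_le0.
Qed.

(** By continuity [chi] is nonzero on a whole neighbourhood of [x], so [x] is interior to the
    interval. The strict bounds later keep the sampled intervals strictly on one side of [t]. *)
Lemma continuous_supp_itv chi L : continuous chi ->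
  supp chi `<=` `[- L, L]%classic -> forall x, chi x != 0 -> - L < x < L.
Proof.
move=> chi_cont chi_supp x chix0.
have : `[- L, L]%classic° x.
  apply: (@filterS _ (nbhs x) _ [set y | chi y != 0]).
    by move=> y chiy0; apply: chi_supp; exact: subset_closure.
  exact: cvgr_neq0 (chi_cont x) chix0.
by rewrite interior_itv /= in_itv.
Qed.

Lemma continuous_bounded_itvcc (g : R -> R) (x y : R) : continuous g ->
  exists2 M, 0 <= M & forall z, z \in `[x, y] -> `|g z| <= M.
Proof.
move=> g_cont.
have /compact_bounded/pinfty_ex_gt0[M M0 hM] : compact (g @` `[x, y]%classic).
  apply: continuous_compact; last exact: segment_compact.
  exact: continuous_subspaceT.
by exists M; [exact: ltW | move=> z zxy; apply: hM; exists z].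
Qed.

Lemma continuous_integrable_itvcc (g : R -> R) (x y : R) : continuous g ->
  mu.-integrable `[x, y]%classic (EFin \o g).
Proof.
move=> g_cont; have [M M0 gM] := continuous_bounded_itvcc x y g_cont.
apply: measurable_bounded_integrable.
- exact: completed_measurable_itv.
- have := ltry (Num.max 0 (y - x)).
  by rewrite -completed_lebesgue_measure_itvcc.
- apply: measurable_funTS => _ Y mY; apply: sub_caratheodory.
  exact: (continuous_measurable_fun g_cont).
- exists M; split; first exact: num_real.
  by move=> K MK z zxy; exact: le_trans (gM z zxy) (ltW MK).
Qed.

Lemma continuous_compact_supp_bounded chi L : continuous chi ->
  (forall x, chi x != 0 -> `|x| <= L) ->
  exists2 M, 0 <= M & forall x, `|chi x| <= M.
Proof.
move=> chi_cont chiL.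
have [M M0 chiM] := continuous_bounded_itvcc (- L) L chi_cont.
exists M => // x; have [->|chix0] := eqVneq (chi x) 0; first by rewrite normr0.
by apply: chiM; rewrite in_itv/= -ler_norml; exact: chiL.
Qed.

(** The bound over duplicate-free lists, uniform in [v], serves both the two-sided series and the
    [\esum] of the moment. *)
Lemma sum_translates_bounded chi L : continuous chi ->
  (forall x, chi x != 0 -> `|x| <= L) ->
  exists C, forall (v : R) (s : seq int), uniq s ->
    \sum_(k <- s) `|chi (v - k%:~R)| <= C.
Proof.
move=> chi_cont chiL.
have [M M0 chiM] := continuous_compact_supp_bounded chi_cont chiL.
pose N := (Num.truncn `|L|).+1.
have LN : `|L| < N%:R by exact: truncnS_gt.
(* At most [2 N + 2] integers lie within distance [N] of [v]. *)
exists (M * (2 * N + 2)%:R) => v s us.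
pose near_v (k : int) := `|v - k%:~R| <= N%:R.
rewrite (bigID near_v)/= [X in _ + X]big1 ?addr0; last first.
  move=> k; apply: contraNeq; rewrite normr_eq0 => /chiL.
  rewrite /near_v => h; apply: le_trans h _.
  by apply: le_trans (ler_norm _) _; exact: ltW.
apply: (@le_trans _ _ (\sum_(k <- s | near_v k) M)).
  by apply: ler_sum => k _; exact: chiM.
rewrite big_const_seq iter_addr_0.
rewrite -(mulr_natr M) ler_wpM2l// ler_nat -size_filter.
(* The relevant integers run from [floor v - N] to [floor v + N]; a duplicate-free list inside the
   window is no longer than the window. *)
pose window := [seq Num.floor v - N%:Z + i%:Z | i <- iota 0 (2 * N + 2)].
have -> : (2 * N + 2)%N = size window by rewrite size_map size_iota.
apply: uniq_leq_size; first exact: filter_uniq.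
move=> k; rewrite mem_filter /near_v ler_norml => /andP[/andP[lo hi] _].
have /andP[fv vf] : (Num.floor v)%:~R <= v < (Num.floor v + 1)%:~R.
  exact: floor_itv.
have kge : Num.floor v - N%:Z <= k.
  by rewrite -(ler_int R) rmorphB/= -pmulrn; lra.
have klt : k < Num.floor v + 1 + N%:Z.
  by rewrite -(ltr_int R) rmorphD/= -pmulrn; lra.
apply/mapP; exists (absz (k - (Num.floor v - N%:Z))%R); first by rewrite mem_iota; lia.
by lia.
Qed.

Lemma continuous_compact_supp_integrable chi L : continuous chi ->
  (forall x, chi x != 0 -> `|x| <= L) -> mu.-integrable setT (EFin \o chi).
Proof.
move=> chi_cont chiL.
have -> : EFin \o chi = (EFin \o chi) \_ `[- L, L]%classic.
  apply/funext => x; rewrite patchE; case: ifPn => //=.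
  rewrite notin_setE/= in_itv/= -ler_norml => xL.
  by congr EFin; apply/eqP; apply: contra_notT xL => /chiL.
have mitv := completed_measurable_itv (`[- L, L]).
apply: (integrable_mkcond (mu := mu) _ mitv).1.
exact: continuous_integrable_itvcc.
Qed.

Lemma continuous_compact_supp_abs_moment chi L : continuous chi ->
  (forall x, chi x != 0 -> `|x| <= L) -> (abs_moment 1 chi < +oo)%E.
Proof.
move=> chi_cont chiL.
(* [chi x * x] is again continuous with compact support. *)
have [|x|C hC] := @sum_translates_bounded (fun x => chi x * x) L.
- by move=> x; apply: continuousM; [exact: chi_cont | exact: cvg_id].
- by rewrite mulf_eq0 negb_or => /andP[/chiL].
apply: (le_lt_trans _ (ltry C)).
(* An [\esum] is the supremum of sums over finite sets [A], and the enumeration of such a set is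
   duplicate-free. *)
apply: ge_ereal_sup => _ [v _ <-]; apply: ge_ereal_sup => _ [A [finA _] <-].
rewrite fsbig_finite//= sumEFin lee_fin.
apply: le_trans (hC v _ (finmap.fset_uniq (fset_set A))).
by apply: ler_sum => k _; rewrite powRr1// normrM.
Qed.

(** * Local means and convergence of the sampling sums *)

Lemma mean_dist_le (f : R -> R) (w l e : R) (k : int) :
  loc_integrable f -> 0 < w ->
  (forall x, x \in `[k%:~R / w, (k + 1)%:~R / w] -> `|f x - l| <= e) ->
  `|w * (\int[mu]_(x in `[(k%:~R / w : R), ((k + 1)%:~R / w : R)]) f x) - l|
    <= e.
Proof.
move=> f_int w0 fl.
have mI := completed_measurable_itv (`[k%:~R / w, (k + 1)%:~R / w]).
have intI := f_int _ (@segment_compact R (k%:~R / w) ((k + 1)%:~R / w)).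
have cstI (c : R) :
    mu.-integrable `[k%:~R / w, (k + 1)%:~R / w]%classic (EFin \o cst c).
  by apply: continuous_integrable_itvcc => x; exact: cvg_cst.
(* The interval has length [1 / w], so [w] times the integral of a constant is that constant;
   monotonicity then compares [f] with [l - e] and [l + e]. *)
have int_cst c :
    w * (\int[mu]_(x in `[(k%:~R / w : R), ((k + 1)%:~R / w : R)]) c) = c.
  transitivity (w * (c * fine (mu `[k%:~R / w, (k + 1)%:~R / w]%classic))).
    by congr (_ * _); exact: (Rintegral_cst mu mI c).
  rewrite completed_lebesgue_measure_itvcc/=.
  rewrite -mulrBl rmorphD/= addrC addKr max_r ?mul1r ?invr_ge0 ?(ltW w0)//.
  by rewrite mulrCA divff ?mulr1// gt_eqF.
rewrite ler_distl; apply/andP; split.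
  rewrite -[leLHS]int_cst ler_pM2l//.
  apply: (le_Rintegral (mu := mu) mI (cstI (l - e)) intI) => x /fl.
  by rewrite ler_distl => /andP[].
rewrite -[leRHS]int_cst ler_pM2l//.
apply: (le_Rintegral (mu := mu) mI intI (cstI (l + e))) => x /fl.
by rewrite ler_distl => /andP[].
Qed.

(** The kernel argument [v] is decoupled from [w * t], so that the shifts of [chi_a] and [chi_b] can
    be absorbed into it. *)
Definition shifted_kantorovich_term chi (w : R) (f : R -> R) (v : R)
    (k : int) : R :=
  chi (v - k%:~R) *
  (w * \int[mu]_(x in `[(k%:~R / w : R), ((k + 1)%:~R / w : R)]) f x).

(* Since the translates of [chi] sum to 1, the deviation from [l] is the sum of
   the [chi (g w - k) * (mean - l)], of absolute value at most [C * e] on each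
   half of the series. *)
Lemma kantorovich_sum_cvg chi L (f g : R -> R) (l : R) : continuous chi ->
  (forall x, chi x != 0 -> `|x| <= L) ->
  (forall v : R, zseries_converges (fun k : int => chi (v - k%:~R)) /\
    zsum (fun k : int => chi (v - k%:~R)) = 1) ->
  loc_integrable f ->
  (forall e, 0 < e -> \forall w \near +oo, forall (k : int) x,
    chi (g w - k%:~R) != 0 -> x \in `[k%:~R / w, (k + 1)%:~R / w] ->
    `|f x - l| <= e) ->
  (\forall w \near +oo,
    zseries_converges (shifted_kantorovich_term chi w f (g w))) /\
  zsum (shifted_kantorovich_term chi w f (g w)) @[w --> +oo] --> l.
Proof.
move=> chi_cont chiL chi1 f_int fl.
pose u w := shifted_kantorovich_term chi w f (g w).
have [C hC] := sum_translates_bounded chi_cont chiL.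
have C0 : 0 <= C by have := hC 0 [::] isT; rewrite big_nil.
have main e : 0 < e -> \forall w \near +oo,
    zseries_converges (u w) /\ `|l - zsum (u w)| <= C * e + C * e.
  move=> e0; near=> w.
  have w0 : 0 < w by near: w; exact: nbhs_pinfty_gt.
  pose d k := chi (g w - k%:~R) *
    (w * (\int[mu]_(x in `[(k%:~R / w : R), ((k + 1)%:~R / w : R)]) f x) - l).
  have [d_cvg d_le] : zseries_converges d /\ `|zsum d| <= C * e + C * e.
    apply: zseries_dominated => s us.
    apply: le_trans (_ : \sum_(k <- s) `|chi (g w - k%:~R)| * e <= _).
      apply: ler_sum => k _; rewrite normrM.
      have [->|chik0] := eqVneq (chi (g w - k%:~R)) 0.
        by rewrite normr0 !mul0r.
      apply: ler_wpM2l => //; apply: mean_dist_le => // x xk.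
      (* The closeness hypothesis is uniform in [k] and [x]: one threshold for [w] serves all
         terms. *)
      by move: k x chik0 xk; near: w; exact: fl.
    by rewrite -mulr_suml ler_wpM2r ?hC// ltW.
  have [chi_cvg chi_sum] := chi1 (g w).
  have [l_cvg l_sum] := zsumZ l chi_cvg.
  have [+ +] := zsumD d_cvg l_cvg.
  rewrite l_sum chi_sum mulr1.
  have -> : (fun k => d k + l * chi (g w - k%:~R)) = u w.
    by apply/funext => k; rewrite /d /u /shifted_kantorovich_term; ring.
  by move=> ? ->; split => //; rewrite distrC addrK.
split; first by apply: filterS (main 1 ltr01) => w [].
apply/cvgrPdist_le => eps eps0.
(* The added 1 keeps the divisor positive even when [C = 0]. *)
have C1 : 0 < C + C + 1 by lra.
have e0 : 0 < eps / (C + C + 1) by rewrite divr_gt0.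
apply: filterS (main _ e0) => w [_ /le_trans]; apply.
rewrite -mulrDl mulrCA ger_pMr// ler_pdivrMr//; lra.
Unshelve. all: by end_near. Qed.

Lemma kantorovich_dom_bounded chi L (f : R -> R) (w : R) : continuous chi ->
  (forall x, chi x != 0 -> `|x| <= L) -> bounded_fun f -> loc_integrable f ->
  0 < w -> kantorovich_dom chi w f.
Proof.
move=> chi_cont chiL /pinfty_ex_gt0[M M0 fM] f_int w0; split => // t.
have [C hC] := sum_translates_bounded chi_cont chiL.
suff [] : zseries_converges (kantorovich_term chi w f t) /\
  `|zsum (kantorovich_term chi w f t)| <= C * M + C * M by [].
apply: zseries_dominated => s us.
apply: le_trans (_ : \sum_(k <- s) `|chi (w * t - k%:~R)| * M <= _).
  apply: ler_sum => k _; rewrite normrM ler_wpM2l//.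
  (* The case [l = 0], [e = M]: the means of [f] inherit its bound. *)
  rewrite -[X in `|X|]subr0; apply: mean_dist_le => // x _.
  by rewrite subr0; exact: fM.
by rewrite -mulr_suml ler_wpM2r ?hC// ltW.
Qed.

End compact_support.

(** * One-sided limits and the position of the sampled intervals *)

Section one_sided_limits.
Context {R : realType}.
Implicit Types (f : R -> R) (w t x d e l : R).

Lemma near_at_right0 (P : R -> Prop) : (\forall e \near 0^'+, P e) ->
  exists2 d : R, 0 < d & forall e, 0 < e < d -> P e.
Proof.
move=> /nbhs_ballP[d /= d0 dP]; exists d => // e /andP[e0 ed].
by apply: dP => //=; rewrite /ball/= sub0r normrN gtr0_norm.
Qed.

Lemma right_lim_dist f t e : cvg (f (t + h) @[h --> 0^'+]) -> 0 < e ->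
  exists2 d, 0 < d & forall x, t < x < t + d -> `|f x - right_lim f t| <= e.
Proof.
move=> /cvgrPdist_le/(_ e) fr /fr/near_at_right0[d d0 hd].
exists d => // x /andP[tx xd].
have := hd (x - t); rewrite (addrC t) subrK distrC; apply.
by rewrite subr_gt0 tx ltrBlDl.
Qed.

Lemma left_lim_dist f t e : cvg (f (t - h) @[h --> 0^'+]) -> 0 < e ->
  exists2 d, 0 < d & forall x, t - d < x < t -> `|f x - left_lim f t| <= e.
Proof.
move=> /cvgrPdist_le/(_ e) fr /fr/near_at_right0[d d0 hd].
exists d => // x /andP[tx xd].
have := hd (t - x); rewrite subKr distrC; apply.
by rewrite subr_gt0 xd ltrBlDl -ltrBlDr.
Qed.

(** The bound on [k] stops at [c - 1] because the interval extends to [(k + 1) / w], which must stay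
    below [t + c / w < t + d]. *)
Lemma node_interval_right w t d c (k : int) x : 0 < w -> c < d * w ->
  w * t < k%:~R < w * t + c - 1 -> x \in `[k%:~R / w, (k + 1)%:~R / w] ->
  t < x < t + d.
Proof.
move=> w0 cdw /andP[tk kt]; rewrite in_itv/= ler_pdivrMr// ler_pdivlMr//.
rewrite rmorphD/= => /andP[kx xk]; apply/andP; split.
  by rewrite -(ltr_pM2r w0); lra.
by rewrite -(ltr_pM2r w0) mulrDl; lra.
Qed.

(** Here the right end [(k + 1) / w] must stay below [t], whence the [- 1] in the upper bound on
    [k]. *)
Lemma node_interval_left w t d c (k : int) x : 0 < w -> c < d * w ->
  w * t - c < k%:~R < w * t - 1 -> x \in `[k%:~R / w, (k + 1)%:~R / w] ->
  t - d < x < t.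
Proof.
move=> w0 cdw /andP[tk kt]; rewrite in_itv/= ler_pdivrMr// ler_pdivlMr//.
rewrite rmorphD/= => /andP[kx xk]; apply/andP; split.
  by rewrite -(ltr_pM2r w0) mulrBl; lra.
by rewrite -(ltr_pM2r w0); lra.
Qed.

End one_sided_limits.

Unset Implicit Arguments.

(** * The combined kernel and the limit at a jump *)

Theorem theorem4p1 (R : realType) (a b : R) (ha : 0 < a) (hb : 0 < b)
    (chi_a chi_b : R -> R)
    (chi_a_continuous : continuous chi_a) (chi_b_continuous : continuous chi_b)
    (chi_a_kernel : is_kernel chi_a) (chi_b_kernel : is_kernel chi_b)
    (chi_a_supp : supp chi_a `<=` `[- a, a]%classic)
    (chi_b_supp : supp chi_b `<=` `[- b, b]%classic)
    (alpha : R) :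
  let chi := fun x : R =>
    (1 - alpha) * chi_a (x - a - 1) + alpha * chi_b (x + b) in
  is_kernel chi /\
  forall f : R -> R, bounded_fun f -> loc_integrable f ->
    (forall w : R, 0 < w -> kantorovich_dom chi w f) /\
    forall t : R, jump_discontinuity f t ->
      kantorovich chi w f t @[w --> +oo] -->
        alpha * right_lim f t + (1 - alpha) * left_lim f t.
Proof.
move=> chi.
have a_supp := continuous_supp_itv chi_a_continuous chi_a_supp.
have b_supp := continuous_supp_itv chi_b_continuous chi_b_supp.
have a_supp' x : chi_a x != 0 -> `|x| <= a.
  by move=> /a_supp /andP[? ?]; rewrite ler_norml !ltW.
have b_supp' x : chi_b x != 0 -> `|x| <= b.
  by move=> /b_supp /andP[? ?]; rewrite ler_norml !ltW.
have [_ a_sum _] := chi_a_kernel; have [_ b_sum _] := chi_b_kernel.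
have chi_cont : continuous chi.
  move=> x; apply: cvgD; apply: cvgMl_tmp; apply: continuous_comp.
  - by apply: cvgB; [apply: cvgB; [exact: cvg_id | exact: cvg_cst]|exact: cvg_cst].
  - exact: chi_a_continuous.
  - by apply: cvgD; [exact: cvg_id | exact: cvg_cst].
  - exact: chi_b_continuous.
(* The shifted [chi_a] lives on []1, 2 a + 1[] and the shifted [chi_b] on []- 2 b, 0[]; [L] covers
   both. *)
pose L := 2 * a + 2 * b + 1.
have chiL x : chi x != 0 -> `|x| <= L.
  rewrite ler_norml /L.
  have [a0|/a_supp /andP[? ?] _] := eqVneq (chi_a (x - a - 1)) 0; last first.
    by apply/andP; split; lra.
  rewrite /chi a0 mulr0 add0r mulf_eq0 negb_or => /andP[_ /b_supp /andP[? ?]].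
  by apply/andP; split; lra.
split.
  split.
  - split; first exact: (continuous_compact_supp_integrable chi_cont chiL).
    have [M M0 chiM] := continuous_compact_supp_bounded chi_cont chiL.
    exists M; split; first exact: num_real.
    by move=> K MK z _; exact: le_trans (chiM z) (ltW MK).
  - move=> v.
    (* Shifting a kernel only moves the point at which its translates are summed, so the total is
       [(1 - alpha) + alpha]. *)
    have [acv asum] := a_sum (v - a - 1); have [bcv bsum] := b_sum (v + b).
    have [acv' asum'] := zsumZ (1 - alpha) acv.
    have [bcv' bsum'] := zsumZ alpha bcv.
    have -> : (fun k : int => chi (v - k%:~R)) = (fun k =>
        (1 - alpha) * chi_a (v - a - 1 - k%:~R) + alpha * chi_b (v + b - k%:~R)).
      by apply/funext => k; rewrite /chi; congr (_ * chi_a _ + _ * chi_b _); ring.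
    have [cv sum] := zsumD acv' bcv'; split => //.
    by rewrite sum asum' bsum' asum bsum !mulr1 subrK.
  - by exists 1 => //; exact: (continuous_compact_supp_abs_moment chi_cont chiL).
move=> f f_bnd f_int; split.
  by move=> w; exact: (kantorovich_dom_bounded chi_cont chiL).
move=> t [f_right f_left _].
have left_part := @kantorovich_sum_cvg _ _ _ f (fun w => w * t - a - 1)
  (left_lim f t) chi_a_continuous a_supp' a_sum f_int.
have right_part := @kantorovich_sum_cvg _ _ _ f (fun w => w * t + b)
  (right_lim f t) chi_b_continuous b_supp' b_sum f_int.
have [|left_conv left_cvg] := left_part.
  move=> e e0; have [d d0 fd] := left_lim_dist f_left e0.
  near=> w => k x /a_supp /andP[lo hi] xk; apply: fd.
  have w0 : 0 < w by near: w; exact: nbhs_pinfty_gt.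
  (* The support of [chi_a] gives [w t - (2 a + 1) < k < w t - 1]; the interval is within [d] of [t]
     once [w > (2 a + 1) / d]. *)
  apply: (@node_interval_left _ w _ _ (2 * a + 1) k) => //.
    by rewrite -ltr_pdivrMl//; near: w; apply: nbhs_pinfty_gt; exact: num_real.
  by apply/andP; split; lra.
have [|right_conv right_cvg] := right_part.
  move=> e e0; have [d d0 fd] := right_lim_dist f_right e0.
  near=> w => k x /b_supp /andP[lo hi] xk; apply: fd.
  have w0 : 0 < w by near: w; exact: nbhs_pinfty_gt.
  (* The support of [chi_b] gives [w t < k < w t + 2 b], that is [c - 1 = 2 b]. *)
  apply: (@node_interval_right _ w _ _ (2 * b + 1) k) => //.
    by rewrite -ltr_pdivrMl//; near: w; apply: nbhs_pinfty_gt; exact: num_real.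
  by apply/andP; split; lra.
have sum_cvg : alpha * zsum (shifted_kantorovich_term chi_b w f (w * t + b)) +
    (1 - alpha) * zsum (shifted_kantorovich_term chi_a w f (w * t - a - 1))
    @[w --> +oo] --> alpha * right_lim f t + (1 - alpha) * left_lim f t.
  by apply: cvgD; apply: cvgMl_tmp.
(* Splitting [zsum] uses convergence of both parts, available for all large [w]; equality there
   determines the limit. *)
apply: cvg_trans sum_cvg; apply: near_eq_cvg.
apply: filterS2 left_conv right_conv => w l_conv r_conv.
have [l_conv' l_sum] := zsumZ (1 - alpha) l_conv.
have [r_conv' r_sum] := zsumZ alpha r_conv.
rewrite -l_sum -r_sum -(zsumD r_conv' l_conv').2.
congr zsum; apply/funext => k.
rewrite /kantorovich_term /shifted_kantorovich_term /chi.
have -> : w * t - a - 1 - k%:~R = w * t - k%:~R - a - 1 by ring.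
have -> : w * t + b - k%:~R = w * t - k%:~R + b by ring.
by ring.
Unshelve. all: by end_near.
Qed.
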